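(* For all lengths $a,b$: $a<b$ or $a=b$ or $b<a$.
   Context: Synthetic plane geometry with classical logic. Primitive notions: points, lines (with equality), incidence $A\in x$, a ternary betweenness relation $\mathrm{Bet}(A,B,C)$ (''$B$ strictly between $A$ and $C$''), a type of lengths with a map $(A,B)\mapsto|AB|$ such that every length equals $|AB|$ for some $A,B$. Points are collinear if some line contains all of them. Axioms: (incidence) there is a point; for every point there is a distinct point; every line has a point; for every line $x$ and $A\in x$ there is $B\in x$, $B\neq A$; for every line there is a point not on it; through two distinct points there is a line; if $A\neq B$, $A,B\in x$ and $x\neq y$ then $A\notin y$ or $B\notin y$. (betweenness) if $\mathrm{Bet}(A,B,C)$ then $A\neq C$, $A,B,C$ collinear, $\mathrm{Bet}(C,B,A)$, and not $\mathrm{Bet}(B,A,C)$. (lengths) $|AB|=|CC|$ iff $A=B$; $|AB|=|BA|$. (line–circle) for $O,A,B$ with $A\neq O$ there is $C$ with ($\mathrm{Bet}(A,O,C)$ or $O=C$) and $|OB|=|OC|$. ''$P,Q$ on opposite sides of line $x$'': $P,Q\notin x$ and some $O\in x$ has $\mathrm{Bet}(P,O,Q)$; ''same side'': $P,Q\notin x$ and no such $O$. (Pasch) if $P,Q$ are on opposite sides of $x$ and $R\notin x$, then $P,R$ or $R,Q$ are on opposite sides of $x$. Write $\mathrm{SR}(O,P,Q)$ for: $O\neq P$, $O\neq Q$, $O,P,Q$ collinear, not $\mathrm{Bet}(P,O,Q)$. (concentric circles) for points $O,A,A',B,B'$: if $\mathrm{Bet}(O,A,B)$, $\mathrm{SR}(O,A',B')$,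 $|OA|=|OA'|$ and $|OB|=|OB'|$, then $\mathrm{Bet}(O,A',B')$ and $|AB|=|A'B'|$. (circle–circle) for points $O,A,B,O',A',B',P$: if $O,O',P$ are not collinear, $\mathrm{Bet}$ holds for each of the triples $(A,A',B),(A,A',B'),(A,B,B'),(A',B,B')$, $\mathrm{Bet}(A,O,B)$ with $|OA|=|OB|$, and $\mathrm{Bet}(A',O',B')$ with $|O'A'|=|O'B'|$, then there is a point $Q$ with $P,Q$ on the same side of the line through $O,O'$, $|OQ|=|OA|$ and $|O'Q|=|O'A'|$. Order: $a<b$ iff there are points $A,B,C$ with $|AB|=a$, $|AC|=b$ and ($\mathrm{Bet}(A,B,C)$ or ($A=B$ and $B\neq C$)). *)

(* Defs.v *)
Set Implicit Arguments.
Unset Strict Implicit.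
Unset Printing Implicit Defensive.

Record geometry := Geometry {
  Point : Type;
  Line : Type;
  Length : Type;
  incident : Point -> Line -> Prop;
  Bet : Point -> Point -> Point -> Prop;  (* [Bet A B C]: B is strictly between A and C *)
  dist : Point -> Point -> Length
}.

Definition collinear (G : geometry) (A B C : Point G) : Prop :=
  exists x : Line G, incident A x /\ incident B x /\ incident C x.

Definition opposite_side (G : geometry) (x : Line G) (P Q : Point G) : Prop :=
  ~ incident P x /\ ~ incident Q x /\ exists O, incident O x /\ Bet P O Q.

Definition same_side (G : geometry) (x : Line G) (P Q : Point G) : Prop :=
  ~ incident P x /\ ~ incident Q x /\ ~ exists O, incident O x /\ Bet P O Q.

Definition same_ray (G : geometry) (O P Q : Point G) : Prop :=
  O <> P /\ O <> Q /\ collinear O P Q /\ ~ Bet P O Q.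

Record plane_axioms (G : geometry) : Prop := PlaneAxioms {
  length_is_dist : forall a : Length G, exists A B : Point G, dist A B = a;

  point_exists : exists A : Point G, True;
  distinct_point_exists : forall A : Point G, exists B : Point G, B <> A;
  line_has_point : forall x : Line G, exists A, incident A x;
  line_has_second_point : forall (x : Line G) (A : Point G),
    incident A x -> exists B, incident B x /\ B <> A;
  point_off_line : forall x : Line G, exists A, ~ incident A x;
  line_through : forall A B : Point G,
    A <> B -> exists x, incident A x /\ incident B x;
  line_unique : forall (A B : Point G) (x y : Line G),
    A <> B -> incident A x -> incident B x -> x <> y ->
    ~ incident A y \/ ~ incident B y;

  bet_neq : forall A B C : Point G, Bet A B C -> A <> C;
  bet_collinear : forall A B C : Point G, Bet A B C -> collinear A B C;
  bet_sym : forall A B C : Point G, Bet A B C -> Bet C B A;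
  bet_asym : forall A B C : Point G, Bet A B C -> ~ Bet B A C;

  dist_null : forall A B C : Point G, dist A B = dist C C <-> A = B;
  dist_sym : forall A B : Point G, dist A B = dist B A;

  line_circle : forall O A B : Point G,
    A <> O -> exists C, (Bet A O C \/ O = C) /\ dist O B = dist O C;

  pasch : forall (x : Line G) (P Q R : Point G),
    opposite_side x P Q -> ~ incident R x ->
    opposite_side x P R \/ opposite_side x R Q;

  concentric_circles : forall O A A' B B' : Point G,
    Bet O A B -> same_ray O A' B' ->
    dist O A = dist O A' -> dist O B = dist O B' ->
    Bet O A' B' /\ dist A B = dist A' B';

  (* Non-collinearity of O, O', P forces O <> O', so the line x is unique. *)
  circle_circle : forall O A B O' A' B' P : Point G,
    ~ collinear O O' P ->
    Bet A A' B -> Bet A A' B' -> Bet A B B' -> Bet A' B B' ->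
    Bet A O B -> dist O A = dist O B ->
    Bet A' O' B' -> dist O' A' = dist O' B' ->
    exists (x : Line G) (Q : Point G),
      incident O x /\ incident O' x /\ same_side x P Q /\
      dist O Q = dist O A /\ dist O' Q = dist O' A'
}.

Definition length_lt (G : geometry) (a b : Length G) : Prop :=
  exists A B C : Point G,
    dist A B = a /\ dist A C = b /\ (Bet A B C \/ (A = B /\ B <> C)).

(* Main.v *)
Require Import Defs.
From Stdlib Require Import Classical.

Set Implicit Arguments.
Unset Strict Implicit.

(* Hilbert's argument from Pasch's axiom shows that of three distinct collinear
   points one lies between the other two.  Together with the circle-circle axiom
   this yields equilateral triangles, hence Euclid's Proposition I.2: every length
   can be copied to every point.  So both lengths can be laid off on one ray from
   the same point, where the trichotomy of betweenness compares them. *)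

(** * Incidence of betweenness triples and prolongation of segments *)

Lemma bet_neq_left (G : geometry) (HG : plane_axioms G) (A B C : Point G) :
  Bet A B C -> A <> B.
Proof. intros H E; subst; exact (bet_asym HG H H). Qed.

Lemma bet_neq_right (G : geometry) (HG : plane_axioms G) (A B C : Point G) :
  Bet A B C -> B <> C.
Proof.
intros H E; exact (bet_neq_left HG (bet_sym HG H) (eq_sym E)).
Qed.

(** The point [P] shows that [x] and [y] differ, so [line_unique] applies. This form serves to
    identify the crossing points that Pasch's axiom yields. *)
Lemma meet_unique (G : geometry) (HG : plane_axioms G) (x y : Line G)
    (P A B : Point G) :
  incident P x -> ~ incident P y ->
  incident A x -> incident A y -> incident B x -> incident B y -> A = B.
Proof.
intros Px Py Ax Ay Bx By.
apply NNPP; intros AB.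
assert (xy : x <> y) by (intros E; subst; contradiction).
destruct (line_unique HG AB Ax Bx xy); contradiction.
Qed.

Lemma collinear_incident (G : geometry) (HG : plane_axioms G) (x : Line G)
    (A B C : Point G) :
  A <> B -> collinear A B C -> incident A x -> incident B x -> incident C x.
Proof.
intros AB [y [Ay [By Cy]]] Ax Bx.
apply NNPP; intros Cx.
exact (AB (meet_unique HG Cy Cx Ay Ax By Bx)).
Qed.

Lemma bet_incident_right (G : geometry) (HG : plane_axioms G) (x : Line G)
    (A B C : Point G) :
  Bet A B C -> incident A x -> incident B x -> incident C x.
Proof.
intros H.
exact (collinear_incident HG (bet_neq_left HG H) (bet_collinear HG H)).
Qed.

Lemma bet_incident_left (G : geometry) (HG : plane_axioms G) (x : Line G)
    (A B C : Point G) :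
  Bet A B C -> incident B x -> incident C x -> incident A x.
Proof.
intros H Bx Cx; exact (bet_incident_right HG (bet_sym HG H) Cx Bx).
Qed.

Lemma bet_incident_mid (G : geometry) (HG : plane_axioms G) (x : Line G)
    (A B C : Point G) :
  Bet A B C -> incident A x -> incident C x -> incident B x.
Proof.
intros H Ax Cx.
destruct (bet_collinear HG H) as [y [Ay [By Cy]]].
apply (collinear_incident HG (bet_neq HG H)); trivial.
exists y; auto.
Qed.

(** This is [line_circle] for the circle through [A] itself; the degenerate case [O = C] would make
    [OA] null. *)
Lemma segment_extension (G : geometry) (HG : plane_axioms G) (A O : Point G) :
  A <> O -> exists C, Bet A O C /\ dist O A = dist O C.
Proof.
intros AO.
destruct (line_circle HG A AO) as [C [[H | H] D]].
- exists C; auto.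
- subst C; apply (dist_null HG) in D; congruence.
Qed.

(** * Order on a line from Pasch's axiom *)

Lemma transversal_exists (G : geometry) (HG : plane_axioms G) (m : Line G)
    (B : Point G) :
  incident B m ->
  exists x, incident B x /\
    forall D, incident D m -> D <> B -> ~ incident D x.
Proof.
intros Bm.
destruct (point_off_line HG m) as [D Dm].
assert (BD : B <> D) by (intros E; subst; contradiction).
destruct (line_through HG BD) as [x [Bx Dx]].
exists x; split; trivial.
intros E Em EB Ex.
exact (EB (meet_unique HG Dx Dm Ex Em Bx Bm)).
Qed.

(** The axiom [pasch] also covers collinear points: a transversal through [B] separates [A] from
    [C], and wherever it then separates [D] from one of them, the crossing point can only be [B]. *)
Lemma pasch_collinear (G : geometry) (HG : plane_axioms G) (m : Line G)
    (A B C D : Point G) :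
  Bet A B C -> incident A m -> incident C m -> incident D m -> D <> B ->
  Bet A B D \/ Bet D B C.
Proof.
intros H Am Cm Dm DB.
assert (Bm := bet_incident_mid HG H Am Cm).
destruct (transversal_exists HG Bm) as [x [Bx off]].
assert (Ax : ~ incident A x) by (apply off; trivial; exact (bet_neq_left HG H)).
assert (Cx : ~ incident C x)
  by (apply off; trivial; exact (not_eq_sym (bet_neq_right HG H))).
assert (opp : opposite_side x A C) by (split; [|split; [|exists B]]; auto).
destruct (pasch HG opp (off _ Dm DB)) as [[_ [_ [O [Ox HO]]]] | [_ [_ [O [Ox HO]]]]].
- left.
  rewrite <- (meet_unique HG Am Ax (bet_incident_mid HG HO Am Dm) Ox Bm Bx).
  exact HO.
- right.
  rewrite <- (meet_unique HG Am Ax (bet_incident_mid HG HO Dm Cm) Ox Bm Bx).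
  exact HO.
Qed.

Lemma bet_trans_outer (G : geometry) (HG : plane_axioms G) (A B C D : Point G) :
  Bet A B C -> Bet B C D -> Bet A B D.
Proof.
intros H1 H2.
destruct (bet_collinear HG H1) as [m [Am [Bm Cm]]].
assert (Dm := bet_incident_right HG H2 Bm Cm).
destruct (pasch_collinear HG H1 Am Cm Dm (not_eq_sym (bet_neq HG H2)))
  as [H | H]; trivial.
destruct (bet_asym HG H2 (bet_sym HG H)).
Qed.

(** The line [x] crosses [BE] at [D] and meets the line [BC] only at [A], outside the segment, so
    Pasch's axiom makes it leave through [CE]. *)
Lemma pasch_segment (G : geometry) (HG : plane_axioms G) (x m : Line G)
    (B D E C A : Point G) :
  Bet B D E -> incident D x -> ~ incident B x ->
  incident A x -> incident A m -> incident B m -> incident C m ->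
  C <> A -> ~ Bet B A C ->
  exists F, incident F x /\ Bet C F E.
Proof.
intros H Dx Bx Ax Am Bm Cm CA nBAC.
assert (Cx : ~ incident C x)
  by (intros Cx; exact (CA (meet_unique HG Bm Bx Cm Cx Am Ax))).
assert (Ex : ~ incident E x)
  by (intros Ex; exact (Bx (bet_incident_left HG H Dx Ex))).
assert (opp : opposite_side x B E) by (split; [|split; [|exists D]]; auto).
destruct (pasch HG opp Cx) as [[_ [_ [O [Ox HO]]]] | [_ [_ HO]]]; trivial.
destruct nBAC.
rewrite <- (meet_unique HG Bm Bx (bet_incident_mid HG HO Bm Cm) Ox Am Ax).
exact HO.
Qed.

(* The letters of Hilbert's proof: [D] is off the line [ABC], [H] lies on [BD]
   beyond [D], [E] is where [AD] meets [CH] and [F] where [CD] meets [AH]. *)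
Lemma bet_trichotomy (G : geometry) (HG : plane_axioms G) (A B C : Point G) :
  collinear A B C -> A <> B -> B <> C -> A <> C ->
  Bet A B C \/ Bet B A C \/ Bet A C B.
Proof.
intros [m [Am [Bm Cm]]] AB BC AC.
destruct (classic (Bet B A C)) as [|nBAC]; [auto|].
destruct (classic (Bet A C B)) as [|nACB]; [auto|].
left.
destruct (point_off_line HG m) as [D Dm].
assert (AD : A <> D) by (intros X; subst; contradiction).
assert (BD : B <> D) by (intros X; subst; contradiction).
assert (CD : C <> D) by (intros X; subst; contradiction).
destruct (segment_extension HG BD) as [H [BDH _]].
destruct (line_through HG AD) as [x [Ax Dx]].
destruct (line_through HG CD) as [y [Cy Dy]].
destruct (line_through HG BD) as [z [Bz Dz]].
assert (Hz := bet_incident_right HG BDH Bz Dz).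
assert (Bx : ~ incident B x)
  by (intros X; exact (AB (meet_unique HG Dx Dm Ax Am X Bm))).
assert (By : ~ incident B y)
  by (intros X; exact (BC (meet_unique HG Dy Dm X Bm Cy Cm))).
assert (Ay : ~ incident A y)
  by (intros X; exact (AC (meet_unique HG Dy Dm X Am Cy Cm))).
assert (Az : ~ incident A z)
  by (intros X; exact (AB (meet_unique HG Dz Dm X Am Bz Bm))).
assert (Cz : ~ incident C z)
  by (intros X; exact (BC (meet_unique HG Dz Dm Bz Bm X Cm))).
assert (Hm : ~ incident H m)
  by (intros X; exact (Dm (bet_incident_mid HG BDH Bm X))).
assert (Hy : ~ incident H y)
  by (intros X; exact (By (bet_incident_left HG BDH Dy X))).
destruct (pasch_segment HG BDH Dx Bx Ax Am Bm Cm (not_eq_sym AC) nBAC)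
  as [E [Ex CEH]].
destruct (pasch_segment HG BDH Dy By Cy Cm Bm Am AC)
  as [F [Fy AFH]]; [intros X; exact (nACB (bet_sym HG X))|].
destruct (bet_collinear HG CEH) as [u [Cu [Eu Hu]]].
assert (Ey : ~ incident E y)
  by (intros X; exact (Hy (bet_incident_right HG CEH Cy X))).
assert (Ez : ~ incident E z)
  by (intros X; exact (Cz (bet_incident_left HG CEH X Hz))).
assert (AE : A <> E)
  by (intros X; subst; exact (Hm (bet_incident_right HG CEH Cm Am))).
(* The line [CD] separates [A] from [H] at [F]. It meets the line [EH] only at [C], not between [E]
   and [H], so it separates [A] from [E], necessarily at [D]. *)
assert (ADE : Bet A D E).
{ assert (opp : opposite_side y A H) by (split; [|split; [|exists F]]; auto).
  destruct (pasch HG opp Ey) as [[_ [_ [O [Oy HO]]]] | [_ [_ [O [Oy HO]]]]].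
  - rewrite <- (meet_unique HG Ax Ay (bet_incident_mid HG HO Ax Ex) Oy Dx Dy).
    exact HO.
  - rewrite (meet_unique HG Hu Hy (bet_incident_mid HG HO Eu Hu) Oy Cu Cy) in HO.
    destruct (bet_asym HG CEH HO). }
(* Likewise [BD] separates [A] from [E] at [D] and meets the line [CE] only at [H], beyond [E]; so
   it separates [A] from [C], at [B]. *)
assert (opp : opposite_side z A E) by (split; [|split; [|exists D]]; auto).
destruct (pasch HG opp Cz) as [[_ [_ [O [Oz HO]]]] | [_ [_ [O [Oz HO]]]]].
- rewrite <- (meet_unique HG Am Az (bet_incident_mid HG HO Am Cm) Oz Bm Bz).
  exact HO.
- rewrite (meet_unique HG Cu Cz (bet_incident_mid HG HO Cu Eu) Oz Hu Hz) in HO.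
  destruct (bet_asym HG (bet_sym HG HO) (bet_sym HG CEH)).
Qed.

Lemma bet_inner_absurd (G : geometry) (HG : plane_axioms G) (A B C P : Point G) :
  Bet A B C -> Bet A P B -> Bet B P C -> False.
Proof.
intros H HA HC.
destruct (bet_collinear HG H) as [m [Am [Bm Cm]]].
assert (Pm := bet_incident_mid HG HA Am Bm).
destruct (pasch_collinear HG H Am Cm Pm (bet_neq_right HG HA)) as [K | K].
- exact (bet_asym HG (bet_sym HG K) (bet_sym HG HA)).
- exact (bet_asym HG HC K).
Qed.

(** If all three held, one of [Q], [R], [S] would lie between the other two, and [P] would lie in
    both halves of that segment. *)
Lemma opposite_rays (G : geometry) (HG : plane_axioms G) (P Q R S : Point G) :
  Bet Q P R -> Bet R P S -> ~ Bet Q P S.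
Proof.
intros QR RS QS.
destruct (bet_collinear HG QR) as [m [Qm [Pm Rm]]].
assert (Sm := bet_incident_right HG QS Qm Pm).
assert (col : collinear Q R S) by (exists m; auto).
destruct (bet_trichotomy HG col (bet_neq HG QR) (bet_neq HG RS) (bet_neq HG QS))
  as [H | [H | H]].
- exact (bet_inner_absurd HG H QR RS).
- exact (bet_inner_absurd HG H (bet_sym HG QR) QS).
- exact (bet_inner_absurd HG H QS (bet_sym HG RS)).
Qed.

(** * Laying off and copying lengths *)

(** Since [line_circle] gives a point beyond [O], the ray is reversed twice: from [A] to [X], then
    from [X] to [C]. *)
Lemma lay_off (G : geometry) (HG : plane_axioms G) (O A B : Point G) :
  O <> A -> O <> B -> exists C, same_ray O A C /\ dist O B = dist O C.
Proof.
intros OA OB.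
destruct (segment_extension HG (not_eq_sym OA)) as [X [AOX _]].
destruct (line_circle HG B (not_eq_sym (bet_neq_right HG AOX)))
  as [C [[XOC | OC] D]].
- exists C; split; trivial.
  destruct (bet_collinear HG AOX) as [m [Am [Om Xm]]].
  repeat split; trivial.
  + exact (bet_neq_right HG XOC).
  + exists m; repeat split; trivial.
    exact (bet_incident_right HG XOC Xm Om).
  + exact (opposite_rays HG AOX XOC).
- subst C; apply (dist_null HG) in D; contradiction.
Qed.

Lemma equilateral_triangle (G : geometry) (HG : plane_axioms G) (O P : Point G) :
  O <> P -> exists D, dist D O = dist O P /\ dist D P = dist O P.
Proof.
intros OP.
destruct (line_through HG OP) as [m [Om Pm]].
destruct (point_off_line HG m) as [R Rm].
(* The order will be [A], [O], [P], [B]: [AP] is a diameter of the circle about [O] through [P], and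
   [OB] of the one about [P] through [O]. *)
destruct (segment_extension HG (not_eq_sym OP)) as [A [POA dA]].
destruct (segment_extension HG OP) as [B [OPB dB]].
assert (nc : ~ collinear O P R)
  by (intros col; exact (Rm (collinear_incident HG OP col Om Pm))).
assert (AOP := bet_sym HG POA).
assert (AOB := bet_trans_outer HG AOP OPB).
assert (APB := bet_sym HG (bet_trans_outer HG (bet_sym HG OPB) POA)).
destruct (circle_circle HG nc AOP AOB APB OPB AOP (eq_sym dA) OPB dB)
  as [x [D [_ [_ [_ [d1 d2]]]]]].
exists D.
rewrite (dist_sym HG D O), (dist_sym HG D P), d1, d2; split.
- symmetry; exact dA.
- exact (dist_sym HG P O).
Qed.

(** On an equilateral triangle [DOP], prolong [DP] by [PQ] to [S] and lay off [DS] along [DO] as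
    [DL]. Subtracting the equal sides [DP] and [DO] leaves [PS] equal to [OL]. *)
Lemma copy_length (G : geometry) (HG : plane_axioms G) (O P Q : Point G) :
  exists R, dist O R = dist P Q.
Proof.
destruct (classic (O = P)) as [E | OP]; [subst O; exists Q; trivial|].
destruct (classic (P = Q)) as [E | PQ].
{ exists O; symmetry; apply (dist_null HG); trivial. }
destruct (equilateral_triangle HG OP) as [D [dO dP]].
assert (DO : D <> O).
{ intros E; subst D; symmetry in dO; apply (dist_null HG) in dO; contradiction. }
assert (DP : D <> P).
{ intros E; subst D; symmetry in dP; apply (dist_null HG) in dP; contradiction. }
destruct (line_circle HG Q DP) as [S [[DPS | PS] dS]].
2: { subst S; apply (dist_null HG) in dS; contradiction. }
destruct (lay_off HG DO (bet_neq HG DPS)) as [L [ray dL]].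
destruct (concentric_circles HG DPS ray (eq_trans dP (eq_sym dO)) dL) as [_ dOL].
exists L; congruence.
Qed.

(** * Comparison of two lengths *)

Unset Implicit Arguments.

Theorem theorem15 (G : geometry) (HG : plane_axioms G) (a b : Length G) :
  length_lt a b \/ a = b \/ length_lt b a.
Proof.
destruct (length_is_dist HG a) as [P [Q <-]].
destruct (length_is_dist HG b) as [R [S <-]].
(* Null lengths are split off because [lay_off] needs proper segments; the degenerate clause of
   [length_lt] compares them. *)
destruct (classic (P = Q)) as [PQ | PQ]; destruct (classic (R = S)) as [RS | RS].
- right; left; subst; apply (dist_null HG); trivial.
- left; exists R, R, S; repeat split; auto.
  symmetry; apply (dist_null HG); trivial.
- right; right; exists P, P, Q; repeat split; auto.
  symmetry; apply (dist_null HG); trivial.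
(* The second length is moved to [P] as [PX], then turned onto the ray [PQ] as [PY]; being on one
   ray excludes [Bet Q P Y]. *)
- destruct (copy_length HG P R S) as [X dX].
  assert (PX : P <> X).
  { intros E; subst X; symmetry in dX; apply (dist_null HG) in dX; contradiction. }
  destruct (lay_off HG PQ PX) as [Y [[_ [PY [col nb]]] dY]].
  assert (dYb : dist P Y = dist R S) by congruence.
  destruct (classic (Q = Y)) as [QY | QY].
  { right; left; congruence. }
  destruct (bet_trichotomy HG col PQ QY PY) as [H | [H | H]].
  + left; exists P, Q, Y; auto.
  + contradiction.
  + right; right; exists P, Y, Q; auto.
Qed.
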